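(* Let $\mathcal M$ and $\mathcal N$ be full subcategories of a category $\mathcal C$, with $\mathcal N$ reflective and $\mathcal M$ coreflective. Let $N:\mathcal C\to\mathcal N$ be a reflector, with unit $\theta:1_{\mathcal C}\to \mathrm{Inc}_{\mathcal N}\circ N$ of $N\dashv\mathrm{Inc}_{\mathcal N}$, and let $M:\mathcal C\to\mathcal M$ be a coreflector, with counit $\psi:\mathrm{Inc}_{\mathcal M}\circ M\to 1_{\mathcal C}$ of $\mathrm{Inc}_{\mathcal M}\dashv M$. Let $\eta$ and $\epsilon$ be the unit and counit of the composite adjunction $N|_{\mathcal M}\dashv M|_{\mathcal N}$. The following conditions are equivalent: (i) for each object $x$ of $\mathcal M$, $(x,\theta_x)$ is a final object in $\mathcal M\downarrow Nx$; (ii) $N|_{\mathcal M}$ is full and faithful; (iii) $\eta$ is a natural isomorphism; (iv) for each object $x$ of $\mathcal M$, $M\theta_x:Mx\to MNx$ is an isomorphism (in $\mathcal M$ and therefore) in $\mathcal C$. Similarly, the following conditions are equivalent: (v) for each object $y$ of $\mathcal N$, $(y,\psi_y)$ is an initial object in $My\downarrow\mathcal N$; (vi) $M|_{\mathcal N}$ is full and faithful; (vii) $\epsilon$ is a natural isomorphism; (viii) for each object $x$ of $\mathcal N$, $N\psi_x:NMx\to Nx$ is an isomorphism (in $\mathcal N$ and therefore) in $\mathcal C$.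
   Context: $\mathrm{Inc}_{\mathcal D}:\mathcal D\to\mathcal C$ denotes the inclusion functor of a subcategory $\mathcal D$. A subcategory $\mathcal N$ is reflective if $\mathrm{Inc}_{\mathcal N}$ has a left adjoint (a reflector); $\mathcal M$ is coreflective if $\mathrm{Inc}_{\mathcal M}$ has a right adjoint (a coreflector). $N|_{\mathcal M}=N\circ\mathrm{Inc}_{\mathcal M}:\mathcal M\to\mathcal N$ and $M|_{\mathcal N}=M\circ\mathrm{Inc}_{\mathcal N}:\mathcal N\to\mathcal M$; composing adjunctions gives $N|_{\mathcal M}\dashv M|_{\mathcal N}$ with unit $\eta_x=(M\theta_x)\circ\sigma_x$ and counit $\epsilon_y=\rho_y\circ(N\psi_y)$, where $\sigma:1_{\mathcal M}\to M\circ\mathrm{Inc}_{\mathcal M}$ is the unit of $\mathrm{Inc}_{\mathcal M}\dashv M$ and $\rho:N\circ\mathrm{Inc}_{\mathcal N}\to 1_{\mathcal N}$ is the counit of $N\dashv\mathrm{Inc}_{\mathcal N}$. For an object $c$ of $\mathcal C$ and a subcategory $\mathcal D$, the comma category $c\downarrow\mathcal D$ has as objects pairs $(y,f)$ with $y\in\mathcal D$ and $f:c\to y$ in $\mathcal C$, morphisms $(y,f)\to(z,g)$ being $h:y\to z$ in $\mathcal D$ with $h\circ f=g$; $\mathcal D\downarrow c$ has as objects pairs $(y,f)$ with $y\in\mathcal D$ and $f:y\to c$ in $\mathcal C$, morphisms $(y,f)\to(z,g)$ being $h:y\to z$ in $\mathcal D$ with $g\circ h=f$. *)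

(* Defs.v *)
From mathcomp Require Import all_boot.
From Stdlib Require Import ProofIrrelevance.

Set Implicit Arguments.
Unset Strict Implicit.
Unset Printing Implicit Defensive.

Reserved Notation "g \c f" (at level 50, left associativity).

Record category := Category {
  Ob :> Type;
  Hom : Ob -> Ob -> Type;
  idc : forall x, Hom x x;
  comp : forall x y z, Hom y z -> Hom x y -> Hom x z;
  comp1c : forall x y (f : Hom x y), comp (idc y) f = f;
  compc1 : forall x y (f : Hom x y), comp f (idc x) = f;
  compA : forall w x y z (h : Hom y z) (g : Hom x y) (f : Hom w x),
    comp h (comp g f) = comp (comp h g) f
}.
Arguments Hom {c} x y : rename.
Arguments idc {c} x : rename.
Arguments comp {c x y z} g f : rename.

Notation "g \c f" := (comp g f).

Definition is_iso (C : category) (x y : C) (f : Hom x y) : Prop :=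
  exists g : Hom y x, g \c f = idc x /\ f \c g = idc y.

Definition is_initial (C : category) (x : C) : Prop :=
  forall y : C, exists f : Hom x y, forall g : Hom x y, g = f.

Definition is_final (C : category) (x : C) : Prop :=
  forall y : C, exists f : Hom y x, forall g : Hom y x, g = f.

Record functor (C D : category) := Functor {
  fob :> C -> D;
  fmap : forall x y : C, Hom x y -> Hom (fob x) (fob y);
  fmap1 : forall x, fmap (idc x) = idc (fob x);
  fmapM : forall (x y z : C) (g : Hom y z) (f : Hom x y),
    fmap (g \c f) = fmap g \c fmap f
}.
Arguments fmap {C D} F {x y} f : rename.

Definition full (C D : category) (F : functor C D) : Prop :=
  forall (x y : C) (g : Hom (F x) (F y)), exists f : Hom x y, fmap F f = g.

Definition faithful (C D : category) (F : functor C D) : Prop :=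
  forall (x y : C) (f g : Hom x y), fmap F f = fmap F g -> f = g.

Definition fid (C : category) : functor C C :=
  @Functor C C (fun x => x) (fun _ _ f => f)
    (fun=> erefl) (fun _ _ _ _ _ => erefl).

Definition fcomp (C D E : category) (G : functor D E) (F : functor C D) :
  functor C E.
Proof.
apply: (@Functor C E (fun x => G (F x)) (fun _ _ f => fmap G (fmap F f))).
- by move=> x; rewrite !fmap1.
- by move=> x y z g f; rewrite !fmapM.
Defined.

Record nat_trans (C D : category) (F G : functor C D) := NatTrans {
  ntc :> forall x : C, Hom (F x) (G x);
  ntcP : forall (x y : C) (f : Hom x y), ntc y \c fmap F f = fmap G f \c ntc x
}.

Definition is_nat_iso (C D : category) (F G : functor C D)
  (a : nat_trans F G) : Prop := forall x : C, is_iso (a x).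

(* F is the left adjoint. *)
Record adjunction (C D : category) (F : functor C D) (G : functor D C) :=
  Adjunction {
  unit : nat_trans (fid C) (fcomp G F);
  counit : nat_trans (fcomp F G) (fid D);
  triangleL : forall x : C, counit (F x) \c fmap F (unit x) = idc (F x);
  triangleR : forall y : D, fmap G (counit y) \c unit (G y) = idc (G y)
}.

Definition adj_comp_unit (A B C : category)
    (F : functor A B) (G : functor B A)
    (F' : functor B C) (G' : functor C B)
    (a : adjunction F G) (a' : adjunction F' G') :
  nat_trans (fid A) (fcomp (fcomp G G') (fcomp F' F)).
Proof.
apply: (@NatTrans _ _ (fid A) (fcomp (fcomp G G') (fcomp F' F))
  (fun x => fmap G (unit a' (F x)) \c unit a x)) => x y f /=.
have /= e := ntcP (unit a) f; have /= e' := ntcP (unit a') (fmap F f).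
by rewrite -compA e compA -fmapM e' fmapM -compA.
Defined.

Definition adj_comp_counit (A B C : category)
    (F : functor A B) (G : functor B A)
    (F' : functor B C) (G' : functor C B)
    (a : adjunction F G) (a' : adjunction F' G') :
  nat_trans (fcomp (fcomp F' F) (fcomp G G')) (fid C).
Proof.
apply: (@NatTrans _ _ (fcomp (fcomp F' F) (fcomp G G')) (fid C)
  (fun z => counit a' z \c fmap F' (counit a (G' z)))) => x y f /=.
have /= e := ntcP (counit a) (fmap G' f); have /= e' := ntcP (counit a') f.
by rewrite -compA -fmapM e fmapM compA e' -compA.
Defined.

Definition adj_comp (A B C : category)
    (F : functor A B) (G : functor B A)
    (F' : functor B C) (G' : functor C B)
    (a : adjunction F G) (a' : adjunction F' G') :
  adjunction (fcomp F' F) (fcomp G G').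
Proof.
apply: (@Adjunction _ _ (fcomp F' F) (fcomp G G')
          (adj_comp_unit a a') (adj_comp_counit a a')) => [x|z] /=.
- have /= e := ntcP (counit a) (unit a' (F x)).
  rewrite -compA -fmapM [fmap F (_ \c _)]fmapM compA e -compA.
  by rewrite triangleL compc1 triangleL.
- have /= e := ntcP (unit a') (counit a (G' z)).
  have e1 := congr1 (fmap G) e; rewrite !fmapM in e1.
  rewrite !fmapM -compA [X in _ \c X]compA -e1.
  by rewrite !compA -fmapM triangleR fmap1 comp1c triangleR.
Defined.

Record subcategory (C : category) := Subcategory {
  sub_ob : C -> Prop;
  sub_hom : forall x y : C, Hom x y -> Prop;
  sub_src : forall (x y : C) (f : Hom x y), sub_hom f -> sub_ob x;
  sub_tgt : forall (x y : C) (f : Hom x y), sub_hom f -> sub_ob y;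
  sub_id : forall x : C, sub_ob x -> sub_hom (idc x);
  sub_comp : forall (x y z : C) (g : Hom y z) (f : Hom x y),
    sub_hom g -> sub_hom f -> sub_hom (g \c f)
}.

Lemma sig_eq (T : Type) (P : T -> Prop) (u v : {x | P x}) :
  sval u = sval v -> u = v.
Proof.
by case: u v => [x Px] [y Py] /= e; subst y; rewrite (proof_irrelevance _ Px Py).
Qed.

Definition subcat (C : category) (S : subcategory C) : category.
Proof.
apply: (@Category {x : C | sub_ob S x}
  (fun x y => {f : Hom (sval x) (sval y) | sub_hom S f})
  (fun x => exist _ (idc (sval x)) (sub_id (svalP x)))
  (fun x y z g f => exist _ (sval g \c sval f)
                      (sub_comp (svalP g) (svalP f)))).
- by move=> x y f; apply: sig_eq; apply: comp1c.
- by move=> x y f; apply: sig_eq; apply: compc1.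
- by move=> w x y z h g f; apply: sig_eq; apply: compA.
Defined.
Coercion subcat : subcategory >-> category.

Definition Inc (C : category) (S : subcategory C) : functor S C :=
  @Functor S C (fun x => sval x) (fun _ _ f => sval f)
    (fun=> erefl) (fun _ _ _ _ _ => erefl).

Definition full_subcategory (C : category) (S : subcategory C) : Prop :=
  full (Inc S).

Definition restr (C D : category) (F : functor C D) (S : subcategory C) :
  functor S D := fcomp F (Inc S).

Record under_ob (C : category) (c : C) (D : subcategory C) := Under {
  under_tgt : D;
  under_arr : Hom c (Inc D under_tgt)
}.

Record over_ob (C : category) (D : subcategory C) (c : C) := Over {
  over_src : D;
  over_arr : Hom (Inc D over_src) c
}.

Lemma under_comp (C : category) (c : C) (D : subcategory C)
    (u v w : under_ob c D) (k : Hom (under_tgt v) (under_tgt w))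
    (h : Hom (under_tgt u) (under_tgt v)) :
  fmap (Inc D) k \c under_arr v = under_arr w ->
  fmap (Inc D) h \c under_arr u = under_arr v ->
  fmap (Inc D) (k \c h) \c under_arr u = under_arr w.
Proof. by move=> ek eh; rewrite fmapM -compA eh ek. Qed.

Definition comma_under (C : category) (c : C) (D : subcategory C) : category.
Proof.
apply: (@Category (under_ob c D)
  (fun u v => {h : Hom (under_tgt u) (under_tgt v) |
                 fmap (Inc D) h \c under_arr u = under_arr v})
  (fun u => exist _ (idc (under_tgt u)) (comp1c (under_arr u)))
  (fun u v w k h => exist _ (sval k \c sval h)
                      (under_comp (svalP k) (svalP h)))).
- by move=> u v f; apply: sig_eq; apply: comp1c.
- by move=> u v f; apply: sig_eq; apply: compc1.
- by move=> t u v w h g f; apply: sig_eq; apply: compA.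
Defined.

Lemma over_comp (C : category) (D : subcategory C) (c : C)
    (u v w : over_ob D c) (k : Hom (over_src v) (over_src w))
    (h : Hom (over_src u) (over_src v)) :
  over_arr w \c fmap (Inc D) k = over_arr v ->
  over_arr v \c fmap (Inc D) h = over_arr u ->
  over_arr w \c fmap (Inc D) (k \c h) = over_arr u.
Proof. by move=> ek eh; rewrite fmapM compA ek eh. Qed.

Definition comma_over (C : category) (D : subcategory C) (c : C) : category.
Proof.
apply: (@Category (over_ob D c)
  (fun u v => {h : Hom (over_src u) (over_src v) |
                 over_arr v \c fmap (Inc D) h = over_arr u})
  (fun u => exist _ (idc (over_src u)) (compc1 (over_arr u)))
  (fun u v w k h => exist _ (sval k \c sval h)
                      (over_comp (svalP k) (svalP h)))).
- by move=> u v f; apply: sig_eq; apply: comp1c.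
- by move=> u v f; apply: sig_eq; apply: compc1.
- by move=> t u v w h g f; apply: sig_eq; apply: compA.
Defined.

Definition restr_adj (C : category) (cM cN : subcategory C)
    (N : functor C cN) (M : functor C cM)
    (adjN : adjunction N (Inc cN)) (adjM : adjunction (Inc cM) M) :
  adjunction (restr N cM) (restr M cN) := adj_comp adjM adjN.

Lemma restr_adj_unitE (C : category) (cM cN : subcategory C)
    (N : functor C cN) (M : functor C cM)
    (adjN : adjunction N (Inc cN)) (adjM : adjunction (Inc cM) M) (x : cM) :
  unit (restr_adj adjN adjM) x
  = fmap M (unit adjN (Inc cM x)) \c unit adjM x.
Proof. by []. Qed.

Lemma restr_adj_counitE (C : category) (cM cN : subcategory C)
    (N : functor C cN) (M : functor C cM)
    (adjN : adjunction N (Inc cN)) (adjM : adjunction (Inc cM) M) (y : cN) :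
  counit (restr_adj adjN adjM) y
  = counit adjN y \c fmap N (counit adjM (Inc cN y)).
Proof. by []. Qed.

(* Main.v *)
Require Import Defs.
From mathcomp Require Import all_boot.

(** Transposing along [Inc cM -| M] turns [theta x \c h = f] into
    [eta x \c h = M f \c sigma], so finality of [(x, theta x)] means that
    composing with [eta x] is bijective, i.e. that [eta] is invertible, which
    is full faithfulness of the left adjoint. Full faithfulness of the
    inclusions makes [sigma] and [rho] invertible, so that [eta] is invertible
    iff [M theta] is; the second half is dual. *)

Set Implicit Arguments.
Unset Strict Implicit.
Unset Printing Implicit Defensive.

Lemma is_iso_comp (C : category) (x y z : C) (g : Hom y z) (f : Hom x y) :
  is_iso g -> is_iso f -> is_iso (g \c f).
Proof.
move=> [g' [g'g gg']] [f' [f'f ff']]; exists (f' \c g'); split.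
- by rewrite -Defs.compA [g' \c _]Defs.compA g'g comp1c.
- by rewrite -Defs.compA [f \c _]Defs.compA ff' comp1c.
Qed.

Lemma is_iso_cancelr (C : category) (x y z : C) (g : Hom y z) (f : Hom x y) :
  is_iso f -> is_iso (g \c f) -> is_iso g.
Proof.
move=> [f' [f'f ff']] gf_iso.
have -> : g = (g \c f) \c f' by rewrite -Defs.compA ff' compc1.
by apply: is_iso_comp => //; exists f.
Qed.

Lemma is_iso_cancell (C : category) (x y z : C) (g : Hom y z) (f : Hom x y) :
  is_iso g -> is_iso (g \c f) -> is_iso f.
Proof.
move=> [g' [g'g gg']] gf_iso.
have -> : f = g' \c (g \c f) by rewrite Defs.compA g'g comp1c.
by apply: is_iso_comp => //; exists g.
Qed.

Lemma is_iso_fmap (C D : category) (F : functor C D) (x y : C)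
    (f : Hom x y) : is_iso f -> is_iso (fmap F f).
Proof.
by move=> [g [gf fg]]; exists (fmap F g); rewrite -!fmapM gf fg !fmap1.
Qed.

Lemma Inc_faithful (C : category) (S : subcategory C) : faithful (Inc S).
Proof. by move=> x y f g; apply: sig_eq. Qed.

(** Naturality of the counit pulls [f] to the outside, and [triangleL] cancels what remains. *)
Lemma counit_transposeK (C D : category) (F : functor C D) (G : functor D C)
    (a : adjunction F G) (x : C) (y : D) (f : Hom (F x) y) :
  counit a y \c fmap F (fmap G f \c unit a x) = f.
Proof.
have /= e := ntcP (counit a) f.
by rewrite fmapM Defs.compA e -Defs.compA triangleL compc1.
Qed.

Lemma unit_transposeK (C D : category) (F : functor C D) (G : functor D C)
    (a : adjunction F G) (x : C) (y : D) (g : Hom x (G y)) :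
  fmap G (counit a y \c fmap F g) \c unit a x = g.
Proof.
have /= e := ntcP (unit a) g.
by rewrite fmapM -Defs.compA -e Defs.compA triangleR comp1c.
Qed.

Lemma unit_transpose_inj (C D : category) (F : functor C D)
    (G : functor D C) (a : adjunction F G) (x : C) (y : D)
    (f f' : Hom (F x) y) :
  fmap G f \c unit a x = fmap G f' \c unit a x -> f = f'.
Proof.
by move=> e; rewrite -[f](counit_transposeK a) e counit_transposeK.
Qed.

Lemma counit_transpose_inj (C D : category) (F : functor C D)
    (G : functor D C) (a : adjunction F G) (x : C) (y : D)
    (g g' : Hom x (G y)) :
  counit a y \c fmap F g = counit a y \c fmap F g' -> g = g'.
Proof.
by move=> e; rewrite -[g](unit_transposeK a) e unit_transposeK.
Qed.

(** The inverse at [x] is the preimage under [F] of [counit a (F x)]. This serves twice: for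
    [Inc cM], where the unit is sigma, and for [restr N cM], where it is eta. *)
Lemma fully_faithful_unit_iso (C D : category) (F : functor C D)
    (G : functor D C) (a : adjunction F G) :
  full F -> faithful F -> is_nat_iso (unit a).
Proof.
move=> fullF faithF x.
have [k Fk] := fullF _ _ (counit a (F x)).
have /= e := ntcP (unit a) k.
exists k; split; first by apply: faithF; rewrite fmapM Fk triangleL fmap1.
by rewrite e Fk triangleR.
Qed.

(** Dually, the inverse at [y] is the preimage under [G] of [unit a (G y)]. It serves for [Inc cN]
    (rho) and [restr M cN] (eps). *)
Lemma fully_faithful_counit_iso (C D : category) (F : functor C D)
    (G : functor D C) (a : adjunction F G) :
  full G -> faithful G -> is_nat_iso (counit a).
Proof.
move=> fullG faithG y.
have [k Gk] := fullG _ _ (unit a (G y)).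
have /= e := ntcP (counit a) k.
exists k; split; first by rewrite -e Gk triangleL.
by apply: faithG; rewrite fmapM Gk triangleR fmap1.
Qed.

(** For [F := Inc cM] and [F' := N], this turns the triangle over [N y] that defines an arrow of the
    comma category into an equation about eta. *)
Lemma adj_comp_unit_transpose (A B C : category)
    (F : functor A B) (G : functor B A) (F' : functor B C) (G' : functor C B)
    (a : adjunction F G) (a' : adjunction F' G') (x y : A) (h : Hom x y) :
  fmap G (unit a' (F y) \c fmap F h) \c unit a x
  = unit (adj_comp a a') y \c h.
Proof.
have /= e := ntcP (unit a) h.
by rewrite /= fmapM -Defs.compA -e Defs.compA.
Qed.

Lemma adj_comp_counit_transpose (A B C : category)
    (F : functor A B) (G : functor B A) (F' : functor B C) (G' : functor C B)
    (a : adjunction F G) (a' : adjunction F' G') (x y : C) (h : Hom x y) :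
  counit a' y \c fmap F' (fmap G' h \c counit a (G' x))
  = h \c counit (adj_comp a a') x.
Proof.
have /= e := ntcP (counit a') h.
by rewrite /= fmapM Defs.compA e -Defs.compA.
Qed.

(** Existence of arrows into the final object gives fullness, their uniqueness gives
    faithfulness. *)
Lemma final_restr_fully_faithful (C : category) (cM cN : subcategory C)
    (N : functor C cN) (adjN : adjunction N (Inc cN)) :
  (forall x : cM, is_final
     (Over (unit adjN (Inc cM x)) : comma_over cM (Inc cN (N (Inc cM x))))) ->
  full (restr N cM) /\ faithful (restr N cM).
Proof.
move=> fin; split=> x y.
(* The transpose of [g] under the reflection is an arrow from [x] to [N y], hence an object over
   [N y]. *)
- move=> g; have [[f ef] _] :=
    fin y (Over (fmap (Inc cN) g \c unit adjN (Inc cM x))).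
  exists f; apply: (unit_transpose_inj (a := adjN)).
  by have /= <- := ntcP (unit adjN) (fmap (Inc cM) f).
- move=> f f' eN; have [h uniq] :=
    fin y (Over (unit adjN (Inc cM y) \c fmap (Inc cM) f)).
  have /= nf := ntcP (unit adjN) (fmap (Inc cM) f).
  have /= nf' := ntcP (unit adjN) (fmap (Inc cM) f').
  (* Since [N] identifies [f] and [f'], both are arrows from the same object of the comma category
     to the final one. *)
  have ef' : unit adjN (Inc cM y) \c fmap (Inc cM) f'
             = unit adjN (Inc cM y) \c fmap (Inc cM) f.
    by rewrite /= nf nf' -[sval (fmap N (sval f))]/(sval (fmap (restr N cM) f)) eN.
  have /(congr1 sval) /= -> := uniq (exist _ f erefl).
  by have /(congr1 sval) /= <- := uniq (exist _ f' ef').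
Qed.

(** The dual argument, with objects under [M y] and transposes under the coreflection. *)
Lemma initial_restr_fully_faithful (C : category) (cM cN : subcategory C)
    (M : functor C cM) (adjM : adjunction (Inc cM) M) :
  (forall y : cN, is_initial
     (Under (counit adjM (Inc cN y))
       : comma_under (Inc cM (M (Inc cN y))) cN)) ->
  full (restr M cN) /\ faithful (restr M cN).
Proof.
move=> init; split=> y z.
- move=> g; have [[f ef] _] :=
    init y (Under (counit adjM (Inc cN z) \c fmap (Inc cM) g)).
  exists f; apply: (counit_transpose_inj (a := adjM)).
  by have /= -> := ntcP (counit adjM) (fmap (Inc cN) f).
- move=> f f' eM; have [h uniq] :=
    init y (Under (fmap (Inc cN) f \c counit adjM (Inc cN y))).
  have /= nf := ntcP (counit adjM) (fmap (Inc cN) f).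
  have /= nf' := ntcP (counit adjM) (fmap (Inc cN) f').
  have ef' : fmap (Inc cN) f' \c counit adjM (Inc cN y)
             = fmap (Inc cN) f \c counit adjM (Inc cN y).
    by rewrite /= -nf -nf' -[sval (fmap M (sval f))]/(sval (fmap (restr M cN) f)) eM.
  have /(congr1 sval) /= -> := uniq (exist _ f erefl).
  by have /(congr1 sval) /= <- := uniq (exist _ f' ef').
Qed.

(** After transposition, an arrow [h] from [(w, f)] must satisfy [eta x \c h = M f \c sigma w]; the
    inverse [k] of [eta x] gives its only solution. *)
Lemma restr_unit_iso_final (C : category) (cM cN : subcategory C)
    (N : functor C cN) (M : functor C cM)
    (adjN : adjunction N (Inc cN)) (adjM : adjunction (Inc cM) M) (x : cM) :
  is_iso (unit (restr_adj adjN adjM) x) ->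
  is_final
    (Over (unit adjN (Inc cM x)) : comma_over cM (Inc cN (N (Inc cM x)))).
Proof.
move=> [k [kK Kk]] [w f] /=.
have eh : unit adjN (Inc cM x)
            \c fmap (Inc cM) (k \c (fmap M f \c unit adjM w)) = f.
  apply: (unit_transpose_inj (a := adjM)).
  apply: (etrans (adj_comp_unit_transpose adjM adjN _)).
  by rewrite Defs.compA Kk comp1c.
exists (exist _ (k \c (fmap M f \c unit adjM w)) eh) => -[h e].
(* Once [f] is replaced by [theta x \c h], its transpose is [eta x \c h], and [k] recovers [h]. *)
move: (e) => /= ef; subst f; apply: sig_eq.
apply: esym; apply: etrans (congr1 (fun g => k \c g)
  (adj_comp_unit_transpose adjM adjN h)) _.
by rewrite Defs.compA kK comp1c.
Qed.

(** Here the transposed equation is [h \c eps y = rho w \c N f], solved by composing with the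
    inverse of [eps y] on the right. *)
Lemma restr_counit_iso_initial (C : category) (cM cN : subcategory C)
    (N : functor C cN) (M : functor C cM)
    (adjN : adjunction N (Inc cN)) (adjM : adjunction (Inc cM) M) (y : cN) :
  is_iso (counit (restr_adj adjN adjM) y) ->
  is_initial
    (Under (counit adjM (Inc cN y)) : comma_under (Inc cM (M (Inc cN y))) cN).
Proof.
move=> [k [kK Kk]] [w f] /=.
have eh : fmap (Inc cN) ((counit adjN w \c fmap N f) \c k)
            \c counit adjM (Inc cN y) = f.
  apply: (counit_transpose_inj (a := adjN)).
  apply: (etrans (adj_comp_counit_transpose adjM adjN _)).
  by rewrite -!Defs.compA kK compc1.
exists (exist _ ((counit adjN w \c fmap N f) \c k) eh) => -[h e].
move: (e) => /= ef; subst f; apply: sig_eq.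
apply: esym; apply: etrans (congr1 (fun g => g \c k)
  (adj_comp_counit_transpose adjM adjN h)) _.
by rewrite -Defs.compA Kk compc1.
Qed.

Theorem theorem4p3 (C : category) (cM cN : subcategory C)
    (fullM : full_subcategory cM) (fullN : full_subcategory cN)
    (N : functor C cN) (adjN : adjunction N (Inc cN))
    (M : functor C cM) (adjM : adjunction (Inc cM) M) :
  let theta : nat_trans (fid C) (fcomp (Inc cN) N) := unit adjN in
  let psi : nat_trans (fcomp (Inc cM) M) (fid C) := counit adjM in
  let adjNM : adjunction (restr N cM) (restr M cN) := restr_adj adjN adjM in
  let eta := unit adjNM in
  let eps := counit adjNM in
  [<-> forall x : cM,
         is_final
           (Over (theta (Inc cM x)) : comma_over cM (Inc cN (N (Inc cM x))));
       full (restr N cM) /\ faithful (restr N cM);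
       is_nat_iso eta;
       forall x : cM,
         is_iso (fmap M (theta (Inc cM x)))
         /\ is_iso (fmap (Inc cM) (fmap M (theta (Inc cM x))))]
  /\
  [<-> forall y : cN,
         is_initial
           (Under (psi (Inc cN y)) : comma_under (Inc cM (M (Inc cN y))) cN);
       full (restr M cN) /\ faithful (restr M cN);
       is_nat_iso eps;
       forall x : cN,
         is_iso (fmap N (psi (Inc cN x)))
         /\ is_iso (fmap (Inc cN) (fmap N (psi (Inc cN x))))].
Proof.
move=> theta psi adjNM eta eps.
(* Fullness of the two subcategories enters here, through their inclusions. *)
have sigma_iso : is_nat_iso (unit adjM).
  exact: fully_faithful_unit_iso fullM (@Inc_faithful _ _).
have rho_iso : is_nat_iso (counit adjN).
  exact: fully_faithful_counit_iso fullN (@Inc_faithful _ _).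
split; tfae.
- exact: final_restr_fully_faithful.
- by case; apply: fully_faithful_unit_iso.
- move=> eta_iso x.
  have Mtheta_iso : is_iso (fmap M (theta (Inc cM x))).
    (* [eta x] is [M (theta x) \c sigma x] by definition. *)
    exact: is_iso_cancelr (sigma_iso x) (eta_iso x).
  by split=> //; apply: is_iso_fmap.
- move=> Mtheta_iso x; apply: (restr_unit_iso_final (adjM := adjM)).
  exact: is_iso_comp (Mtheta_iso x).1 (sigma_iso x).
- exact: initial_restr_fully_faithful.
- by case; apply: fully_faithful_counit_iso.
- move=> eps_iso y.
  have Npsi_iso : is_iso (fmap N (psi (Inc cN y))).
    (* [eps y] is [rho y \c N (psi y)], so the invertible factor now cancels on the left. *)
    exact: is_iso_cancell (rho_iso y) (eps_iso y).
  by split=> //; apply: is_iso_fmap.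
- move=> Npsi_iso y; apply: (restr_counit_iso_initial (adjN := adjN)).
  exact: is_iso_comp (rho_iso y) (Npsi_iso y).1.
Qed.
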